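(* Let $d,m_1,\ldots,m_d$ be positive integers, $\boldsymbol{\alpha}=(\alpha_1,\ldots,\alpha_d)\in\mathbb{Q}^d$ with $\alpha_1=0$ and $\alpha_i-\alpha_j\notin\mathbb{Z}$ for $i\ne j$, $\mathcal{I}=\{(i,s):1\le i\le d,\ 1\le s\le m_i+1\}\setminus\{(1,1)\}$, $M=d-1+\sum_im_i$, and let $n\ge0$ be an integer. For $\ell=0,\ldots,M$ let $\mathbf{p}_{n,\ell}(z)$ be the column vector $\big(P_{n,\ell}(z),(Q_{n,i,s,\ell}(z))_{(i,s)\in\mathcal{I}}\big)^{t}$ (with $\mathcal{I}$ ordered lexicographically), and let $\mathrm{Mat}(z)=(\mathbf{p}_{n,0}(z),\ldots,\mathbf{p}_{n,M}(z))$. Then there exists $a\in\mathbb{Q}^\times$ such that $\det\mathrm{Mat}(z)=a$. In particular, for any $x\in\mathbb{Q}$, the vectors $\mathbf{p}_{n,0}(x),\ldots,\mathbf{p}_{n,M}(x)$ are linearly independent over $\mathbb{Q}$.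
   Context: $(x)_n=x(x+1)\cdots(x+n-1)$, $(x)_0=1$; $\binom\alpha k=\alpha(\alpha-1)\cdots(\alpha-k+1)/k!$. $\Delta_{-1}P(z)=P(z-1)-P(z)$. For $f=\sum_{k\ge0}f_kz^{-k-1}\in(1/z)\mathbb{Q}[[1/z]]$, $\varphi_f:\mathbb{Q}[t]\to\mathbb{Q}$ is linear with $t^k\mapsto f_k$, extended $\mathbb{Q}[z]$-linearly to $\mathbb{Q}[z,t]\to\mathbb{Q}[z]$. Modified inverse Mellin transform: for $g\in\mathbb{Q}[[z]]$, write $g(e^z-1)=\sum_kb_kz^k/k!$, $\mathcal{M}^{-1}(g)=\sum_kb_k(-1/z)^{k+1}$. $R_{\alpha,s}=\mathcal{M}^{-1}\big((1+z)^\alpha\log^{s-1}(1+z)/z\big)$ for $s\ge2$, $R_{\alpha,1}=\mathcal{M}^{-1}\big(((1+z)^\alpha-1)/z\big)$, $\varphi_{\alpha,s}=\varphi_{R_{\alpha,s}}$. $A_{n,\ell}(z)=(-1)^\ell\frac{(z)_\ell}{\ell!}\prod_{i=1}^d\big((-1)^n\frac{(z+\alpha_i)_n}{n!}\big)^{m_i+1}$, $P_{n,\ell}(z)=\Delta_{-1}^n(A_{n,\ell}(z))$, $Q_{n,i,s,\ell}(z)=\varphi_{\alpha_i,s}\big(\frac{P_{n,\ell}(z)-P_{n,\ell}(t)}{z-t}\big)$. *)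

(* Defs.v *)
From HB Require Import structures.
From mathcomp Require Import all_boot all_order all_algebra.

Set Implicit Arguments.
Unset Strict Implicit.
Unset Printing Implicit Defensive.

Import Order.TTheory GRing.Theory Num.Theory.
Local Open Scope ring_scope.

(* Formal power series over the rationals, as coefficient sequences: [g k] is
   the coefficient of z^k. *)
Definition series := nat -> rat.

Definition smul (f g : series) : series :=
  fun k => \sum_(i < k.+1) f i * g (k - i)%N.

Definition sone : series := fun k => (k == 0%N)%:R.

Definition sexp (f : series) (n : nat) : series := iter n (smul f) sone.

(* The substitution g(u); when u has zero constant term, the powers u^j with
   j > k do not contribute to the coefficient of z^k. *)
Definition scomp (g u : series) : series :=
  fun k => \sum_(j < k.+1) g j * sexp u j k.

(* g / z, for g without constant term. *)
Definition sdivz (g : series) : series := fun k => g k.+1.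

Definition gbinom (a : rat) (k : nat) : rat :=
  (\prod_(i < k) (a - i%:R)) / k`!%:R.

(* (1 + z)^a *)
Definition binom_series (a : rat) : series := gbinom a.

(* log (1 + z) *)
Definition log1p_series : series :=
  fun k => if k is j.+1 then (-1) ^+ j / k%:R else 0.

(* e^z - 1 *)
Definition expm1_series : series :=
  fun k => if k is 0%N then 0 else k`!%:R^-1.

(* Elements of (1/z) Q[[1/z]] are also sequences, but here [f k] is the
   coefficient of z^(-k-1). *)
Definition inv_series := nat -> rat.

(* If g(e^z - 1) = sum_k b_k z^k / k!, the coefficient of z^(-k-1) in
   sum_k b_k (-1/z)^(k+1) is (-1)^(k+1) b_k. *)
Definition inv_mellin (g : series) : inv_series :=
  fun k => (-1) ^+ k.+1 * (k`!%:R * scomp g expm1_series k).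

Definition Rfun (a : rat) (s : nat) : inv_series :=
  inv_mellin (sdivz
    (if s == 1%N then fun k => binom_series a k - sone k
     else smul (binom_series a) (sexp log1p_series s.-1))).

(* Q[z,t] is {poly {poly rat}}: t is the outer variable 'X, z is 'X%:P.
   This is the Q[z]-linear extension of t^k |-> f_k. *)
Definition phi (f : inv_series) (p : {poly {poly rat}}) : {poly rat} :=
  \sum_(k < size p) f k *: p`_k.

(* (P(z) - P(t)) / (z - t). The leading coefficient of z - t in t is the unit
   -1, so the quotient is exact: see [divdiffK]. *)
Definition divdiff (P : {poly rat}) : {poly {poly rat}} :=
  (P%:P - P^:P) %/ ('X%:P - 'X).

Lemma divdiffK (P : {poly rat}) : divdiff P * ('X%:P - 'X) = P%:P - P^:P.
Proof.
have u : lead_coef ('X%:P - 'X : {poly {poly rat}}) \is a GRing.unit.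
  by rewrite -opprB lead_coefN lead_coefXsubC rpredN unitr1.
apply: (Pdiv.IdomainUnit.divpK u).
rewrite -opprB dvdpNl dvdp_XsubCl rootE hornerD hornerN hornerC.
by rewrite -[X in X - _]comp_polyXr /comp_poly subrr.
Qed.

(* Rising factorial (x)_n. *)
Definition poch (x : {poly rat}) (n : nat) : {poly rat} :=
  \prod_(k < n) (x + k%:R).

(* Delta_{-1} *)
Definition deltaN1 (P : {poly rat}) : {poly rat} := P \Po ('X - 1) - P.

Section Vectors.
Variables (d : nat) (m : 'I_d -> nat) (alpha : 'I_d -> rat).

Definition Apoly (n l : nat) : {poly rat} :=
  ((-1) ^+ l / l`!%:R) *: poch 'X l *
  \prod_(i < d) (((-1) ^+ n / n`!%:R) *: poch ('X + (alpha i)%:P) n)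
                  ^+ (m i).+1.

Definition Ppoly (n l : nat) : {poly rat} := iter n deltaN1 (Apoly n l).

Definition Qpoly (n : nat) (i : 'I_d) (s l : nat) : {poly rat} :=
  phi (Rfun (alpha i) s) (divdiff (Ppoly n l)).

(* The index set I in lexicographic order. The ordinal i is counted from 0 and
   s from 1, so the removed pair (1,1) is (0,1) here. *)
Definition Iset : seq ('I_d * nat) :=
  [seq p <- [seq (i, s) | i <- enum 'I_d, s <- iota 1 (m i).+1]
     | (val p.1, p.2) != (0%N, 1%N)].

Definition Mdim : nat := (d - 1 + \sum_(i < d) m i)%N.

Lemma size_Iset : (0 < d)%N -> size Iset = Mdim.
Proof.
move=> d_gt0; pose o := Ordinal d_gt0.
rewrite /Iset size_filter; set s := (X in count _ X).
have sz : size s = (\sum_(i < d) (m i).+1)%N.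
  rewrite size_allpairs_dep sumnE big_map big_enum /=.
  by apply: eq_bigr => i _; rewrite size_iota.
have us : uniq s.
  apply: allpairs_uniq_dep; first exact: enum_uniq.
    by move=> i _; apply: iota_uniq.
  by move=> [x x'] [y y'] _ _ /= [-> ->].
have os : (o, 1%N) \in s.
  by apply: allpairs_f_dep; rewrite ?mem_enum // mem_iota.
have := count_predC (pred1 (o, 1%N)) s.
rewrite (count_uniq_mem _ us) os sz.
rewrite (eq_count (a2 := fun p => (val p.1, p.2) != (0%N, 1%N))); last first.
  by move=> [x y] /=; rewrite !xpair_eqE -val_eqE.
under eq_bigr do rewrite -addn1.
rewrite big_split /= sum1_card card_ord /Mdim => h.
by apply/eqP; rewrite -(eqn_add2l true) h /= addnA subnKC // addnC.
Qed.

(* By [size_Iset] the list below has Mdim.+1 entries, so the default value 0 of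
   the nth notation is never used. *)
Definition pvec (n l : nat) : 'cV[{poly rat}]_(Mdim.+1) :=
  \col_r (Ppoly n l :: [seq Qpoly n p.1 p.2 l | p <- Iset])`_r.

Definition Mat (n : nat) : 'M[{poly rat}]_(Mdim.+1) :=
  \matrix_(r, l) pvec n l r 0.

Definition pvec_at (n l : nat) (x : rat) : 'cV[rat]_(Mdim.+1) :=
  map_mx (fun P : {poly rat} => P.[x]) (pvec n l).

End Vectors.

(* Main.v *)
Require Import Defs.
From Stdlib Require Import FunctionalExtensionality.
From HB Require Import structures.
From mathcomp Require Import all_boot all_order all_algebra all_field.
From mathcomp Require Import ring zify.

(* In the variable T = -t the operator Delta_{-1} becomes the forward difference
   delta F = F(T+1) - F(T), and phi_{alpha,s} is characterised by
   phi(delta F) = -F^(s-1)(alpha) for s >= 2, F(0) - F(alpha) for s = 1.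
   Summation by parts then gives phi(q P_{n,l}) = 0 for deg q < n.
   The determinant is a nonzero constant as soon as Mat(x) is injective for
   every x in an algebraically closed field. A kernel vector at x yields a
   combination P = (t - x) S of the P_{n,l} such that phi(q S) = 0 for all
   deg q <= n and all phi. Write S = delta F with F(0) = 0: then F vanishes at
   every alpha_i to order m_i + 1, and F(T+1) is again orthogonal to all q with
   deg q <= n - 1. After n + 1 such steps the polynomial has more zeros than its
   degree allows, so S = 0. *)

Set Implicit Arguments.
Unset Strict Implicit.
Unset Printing Implicit Defensive.
Import Order.TTheory GRing.Theory Num.Theory.
Local Open Scope ring_scope.

(** * Power series calculus: the derivation (1+z) d/dz *)

Definition sderiv (g : series) : series := fun k => k.+1%:R * g k.+1.

(** The operator (1+z) d/dz. Under z = e^w - 1 it becomes d/dw. *)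
Definition theta (g : series) : series :=
  fun k => k.+1%:R * g k.+1 + k%:R * g k.

Local Arguments sexp : simpl never.

(** The Leibniz rule for z d/dz, which comes from splitting k = i + (k - i). *)
Lemma euler_smul (f g : series) k :
  k%:R * smul f g k = smul (fun j => j%:R * f j) g k
                      + smul f (fun j => j%:R * g j) k.
Proof.
rewrite /smul mulr_sumr -big_split; apply: eq_bigr => i _ /=.
have -> : k%:R = i%:R + (k - i)%:R :> rat by rewrite -natrD subnKC // -ltnS.
by ring.
Qed.

Lemma sderiv_smul (f g : series) k :
  sderiv (smul f g) k = smul (sderiv f) g k + smul f (sderiv g) k.
Proof.
rewrite /sderiv euler_smul /smul; congr (_ + _).
  rewrite big_ord_recl mul0r mul0r add0r.
  by apply: eq_bigr => i _; rewrite lift0 subSS.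
rewrite big_ord_recr /= subnn mul0r mulr0 addr0.
by apply: eq_bigr => i _; rewrite subSn // -ltnS.
Qed.

Lemma smulDl (f1 f2 g : series) k :
  smul (fun j => f1 j + f2 j) g k = smul f1 g k + smul f2 g k.
Proof. by rewrite -big_split; apply: eq_bigr => i _; rewrite mulrDl. Qed.

Lemma smulDr (f g1 g2 : series) k :
  smul f (fun j => g1 j + g2 j) k = smul f g1 k + smul f g2 k.
Proof. by rewrite -big_split; apply: eq_bigr => i _; rewrite mulrDr. Qed.

Lemma smulZl c (f g : series) k : smul (fun j => c * f j) g k = c * smul f g k.
Proof. by rewrite mulr_sumr; apply: eq_bigr => i _; rewrite mulrA. Qed.

Lemma smulZr c (f g : series) k : smul f (fun j => c * g j) k = c * smul f g k.
Proof. by rewrite mulr_sumr; apply: eq_bigr => i _; rewrite mulrCA. Qed.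

Lemma smul1s (f : series) : smul sone f = f.
Proof.
apply: functional_extensionality => k.
rewrite /smul big_ord_recl /sone /= mul1r subn0 big1 ?addr0 // => i _.
by rewrite mul0r.
Qed.

Lemma smuls1 (f : series) : smul f sone = f.
Proof.
apply: functional_extensionality => k.
rewrite /smul big_ord_recr /sone /= subnn mulr1 big1 ?add0r // => i _.
by rewrite subn_eq0 leqNgt ltn_ord mulr0.
Qed.

Lemma theta_smul (f g : series) k :
  theta (smul f g) k = smul (theta f) g k + smul f (theta g) k.
Proof.
have E h : theta h = fun j => sderiv h j + j%:R * h j by [].
rewrite !E smulDl smulDr sderiv_smul euler_smul.
by rewrite addrACA.
Qed.

(** With u = e^z - 1 one has u' = 1 + u, hence (u^(j+1))' = (j+1) u^j (1 + u). *)
Lemma sderiv_expm1_exp j k :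
  sderiv (sexp expm1_series j.+1) k
  = j.+1%:R * (sexp expm1_series j k + sexp expm1_series j.+1 k).
Proof.
have u' : sderiv expm1_series = fun k => sone k + expm1_series k.
  apply: functional_extensionality => -[|i].
    by rewrite /sderiv /sone /= (_ : 1`! = 1%N) // invr1 mulr1 addr0.
  rewrite /sderiv /sone /= add0r factS natrM invfM mulrA divff ?mul1r //.
  by rewrite pnatr_eq0.
elim: j k => [|j IH] k.
  by rewrite /sexp /= smuls1 u' mul1r.
have S i : sexp expm1_series i.+1 = smul expm1_series (sexp expm1_series i).
  by [].
rewrite [in LHS]S sderiv_smul u' smulDl smul1s -S.
have -> : sderiv (sexp expm1_series j.+1) =
  fun k => j.+1%:R * (sexp expm1_series j k + sexp expm1_series j.+1 k).
  exact: functional_extensionality.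
rewrite smulZr smulDr -!S -[j.+2%:R]natr1; ring.
Qed.

Lemma sexp_expm1_small j k : (k < j)%N -> sexp expm1_series j k = 0.
Proof.
elim: k j => [|k IH] [|j] // kj.
  by rewrite /sexp /= /smul big_ord1 mul0r.
have := sderiv_expm1_exp j k; rewrite /sderiv !IH ?addr0 ?mulr0 //; last lia.
by move/eqP; rewrite mulf_eq0 pnatr_eq0 /= => /eqP.
Qed.

Lemma scomp_expm1S (g : series) k :
  k.+1%:R * scomp g expm1_series k.+1 = scomp (theta g) expm1_series k.
Proof.
rewrite /scomp big_ord_recl [sexp _ ord0 _](_ : _ = 0) // mulr0 add0r mulr_sumr.
transitivity (\sum_(i < k.+1) (i.+1%:R * g i.+1 * sexp expm1_series i k
    + i.+1%:R * g i.+1 * sexp expm1_series i.+1 k)).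
  apply: eq_bigr => i _; rewrite lift0 mulrCA.
  by rewrite (sderiv_expm1_exp i k : _ * sexp _ _ _ = _); ring.
under [RHS]eq_bigr do rewrite /theta mulrDl.
rewrite !big_split /=; congr (_ + _).
(* Index shift: the last term on the left contains the coefficient of z^k in u^(k+1), which is 0;
   the first term on the right has the factor 0. *)
rewrite big_ord_recr /= [sexp _ _.+1 _]sexp_expm1_small // mulr0 addr0.
rewrite [RHS]big_ord_recl mul0r mul0r add0r.
by apply: eq_bigr => i _; rewrite lift0; ring.
Qed.

(* Since d/dw g(e^w - 1) = (theta g)(e^w - 1), iterating theta extracts the
   Taylor coefficients of g(e^w - 1). *)
Lemma inv_mellinE (g : series) k :
  inv_mellin g k = (-1) ^+ k.+1 * iter k theta g 0%N.
Proof.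
rewrite /inv_mellin; congr (_ * _).
elim: k g => [|k IH] g.
  by rewrite /scomp big_ord1 fact0 mul1r /sexp /sone /= mulr1.
by rewrite iterSr -IH -scomp_expm1S factS natrM; ring.
Qed.

Lemma theta_binom a : theta (binom_series a) = fun k => a * binom_series a k.
Proof.
apply: functional_extensionality => k.
rewrite /theta /binom_series /gbinom big_ord_recr /= factS natrM.
have kn0 : k.+1%:R != 0 :> rat by rewrite pnatr_eq0.
have fn0 : k`!%:R != 0 :> rat by rewrite pnatr_eq0 -lt0n fact_gt0.
move: kn0; rewrite -natr1 => kn0; field.
by rewrite fn0 kn0.
Qed.

Lemma theta_log1p : theta log1p_series = sone.
Proof.
apply: functional_extensionality => -[|k].
  by apply/eqP.
rewrite /theta /log1p_series /sone /= [_%:R * (_ / _)]mulrC divfK ?pnatr_eq0 //.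
by rewrite [_%:R * (_ / _)]mulrC divfK ?pnatr_eq0 // exprS mulN1r addNr.
Qed.

Lemma theta_sone : theta sone = fun=> 0.
Proof.
by apply: functional_extensionality => -[|k];
  rewrite /theta /sone /= ?mulr0 ?mul0r addr0.
Qed.

(** Since log(1+z) becomes w, this is the derivative of w^j. For j = 0 the truncated exponent is
    harmless, because the factor is 0. *)
Lemma theta_log1p_exp j k :
  theta (sexp log1p_series j) k = j%:R * sexp log1p_series j.-1 k.
Proof.
elim: j k => [|j IH] k; first by rewrite theta_sone mul0r.
have -> : sexp log1p_series j.+1 = smul log1p_series (sexp log1p_series j).
  by [].
rewrite theta_smul theta_log1p smul1s /=.
have -> : theta (sexp log1p_series j) =
   fun k => j%:R * sexp log1p_series j.-1 k.
  exact: functional_extensionality.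
rewrite smulZr; case: j {IH} => [|j]; first by rewrite mul0r addr0 mul1r.
by rewrite -[j.+2%:R]natr1 mulrDl mul1r addrC.
Qed.

Lemma theta_binom_log a j k :
  theta (smul (binom_series a) (sexp log1p_series j)) k
  = a * smul (binom_series a) (sexp log1p_series j) k
    + j%:R * smul (binom_series a) (sexp log1p_series j.-1) k.
Proof.
rewrite theta_smul theta_binom smulZl -[_%:R * _]smulZr; congr (_ + smul _ _ _).
by apply: functional_extensionality => i; exact: theta_log1p_exp.
Qed.

Lemma iter_thetaD (f g : series) n k :
  iter n theta (fun j => f j + g j) k = iter n theta f k + iter n theta g k.
Proof. by elim: n k => //= n IH k; rewrite /theta !IH; ring. Qed.

Lemma iter_thetaZ c (g : series) n k :
  iter n theta (fun j => c * g j) k = c * iter n theta g k.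
Proof. by elim: n k => //= n IH k; rewrite /theta !IH; ring. Qed.

(** * Moment functionals and the forward difference *)

Section Moments.
Variable L : comNzRingType.

(** The counterpart of [phi] once z has been specialised to a scalar. *)
Definition moment (b : nat -> L) (p : {poly L}) : L :=
  \sum_(k < size p) p`_k * b k.

Lemma momentE b (p : {poly L}) n :
  (size p <= n)%N -> moment b p = \sum_(k < n) p`_k * b k.
Proof.
move=> le_pn; rewrite /moment (big_ord_widen _ (fun k => p`_k * b k) le_pn).
rewrite big_mkcond; apply: eq_bigr => i _; case: ltnP => // le_pi.
by rewrite nth_default ?mul0r.
Qed.

Lemma moment_is_scalar b : scalar (moment b).
Proof.
move=> a p q; pose n := maxn (size p) (size q).
have le_pq : (size (a *: p + q)%R <= n)%N.
  rewrite (leq_trans (size_polyD _ _)) // geq_max leq_maxr andbT.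
  by rewrite (leq_trans (size_scale_leq _ _)) ?leq_maxl.
rewrite (momentE _ le_pq) (momentE _ (leq_maxl _ _ : (size p <= n)%N)).
rewrite (momentE _ (leq_maxr _ _ : (size q <= n)%N)) mulr_sumr -big_split.
by apply: eq_bigr => i _; rewrite coefD coefZ mulrDl mulrA.
Qed.

HB.instance Definition _ b :=
  GRing.isLinear.Build L {poly L} L *%R (moment b) (moment_is_scalar b).

Lemma momentC b c : moment b c%:P = c * b 0%N.
Proof. by rewrite (momentE _ (size_polyC_leq1 c)) big_ord1 coefC. Qed.

Lemma momentMX b (p : {poly L}) :
  moment b (p * 'X) = moment (fun k => b k.+1) p.
Proof.
have le_pX : (size (p * 'X)%R <= (size p).+1)%N.
  by have [->|/size_mulX ->] := eqVneq p 0; rewrite ?mul0r ?size_poly0.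
rewrite (momentE _ le_pX) big_ord_recl coefMX mul0r add0r.
by apply: eq_bigr => i _; rewrite coefMX lift0.
Qed.

Lemma eq_moment b1 b2 (p : {poly L}) : b1 =1 b2 -> moment b1 p = moment b2 p.
Proof. by move=> e; apply: eq_bigr => i _; rewrite e. Qed.

Lemma moment_seqD b1 b2 (p : {poly L}) :
  moment (fun k => b1 k + b2 k) p = moment b1 p + moment b2 p.
Proof. by rewrite -big_split; apply: eq_bigr => i _; rewrite mulrDr. Qed.

Lemma moment_seqZ c b (p : {poly L}) :
  moment (fun k => c * b k) p = c * moment b p.
Proof. by rewrite mulr_sumr; apply: eq_bigr => i _; rewrite mulrCA. Qed.

Lemma moment_compN b (p : {poly L}) :
  moment b (p \Po (- 'X)) = moment (fun k => (-1) ^+ k * b k) p.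
Proof.
elim/poly_ind: p b => [|p c IH] b; first by rewrite comp_poly0 !raddf0.
rewrite comp_poly_MXaddC !raddfD /= mulrN raddfN /= !momentMX IH !momentC.
rewrite expr0 mul1r; congr (_ + _); rewrite -[LHS]mulN1r -moment_seqZ.
by apply: eq_moment => k; rewrite exprS mulrA.
Qed.

Definition fdelta (p : {poly L}) : {poly L} := p \Po ('X + 1) - p.

Lemma fdelta_is_linear : linear fdelta.
Proof.
move=> a p q; rewrite /fdelta comp_polyD comp_polyZ scalerBr.
by rewrite opprD addrACA.
Qed.

HB.instance Definition _ :=
  GRing.isLinear.Build L {poly L} {poly L} _ fdelta fdelta_is_linear.

Lemma fdeltaC c : fdelta c%:P = 0.
Proof. by rewrite /fdelta comp_polyC subrr. Qed.

Lemma fdeltaMX (p : {poly L}) :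
  fdelta (p * 'X) = fdelta p * 'X + (p \Po ('X + 1)).
Proof.
by rewrite /fdelta comp_polyM comp_polyX mulrDr mulr1 mulrBl addrAC.
Qed.

(** Twisted Leibniz rule. Solved for either term on the right, it is summation by parts. *)
Lemma fdeltaM (p q : {poly L}) :
  fdelta (p * q) = p * fdelta q + fdelta p * (q \Po ('X + 1)).
Proof. by rewrite /fdelta comp_polyM mulrBr mulrBl [RHS]addrC addrA subrK. Qed.

End Moments.

(** * The functionals attached to the inverse Mellin transform *)

Section MellinFunctional.
Variables (L : fieldType) (iota : {rmorphism rat -> L}).

(** The map p -> (p(theta) g)(0): it pairs p with the Taylor data of g(e^w - 1) at w = 0. *)
Definition mellin (g : series) : {poly L} -> L :=
  moment (fun k => iota (iter k theta g 0%N)).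

HB.instance Definition _ g := GRing.Linear.on (mellin g).

Lemma mellinC g c : mellin g c%:P = c * iota (g 0%N).
Proof. exact: momentC. Qed.

Lemma mellinMX g p : mellin g (p * 'X) = mellin (theta g) p.
Proof.
by rewrite /mellin momentMX; apply: eq_moment => k; rewrite -iterSr.
Qed.

Lemma mellin_seriesD f g p :
  mellin (fun k => f k + g k) p = mellin f p + mellin g p.
Proof.
rewrite -moment_seqD; apply: eq_moment => k.
by rewrite iter_thetaD rmorphD.
Qed.

Lemma mellin_seriesZ c g p : mellin (fun k => c * g k) p = iota c * mellin g p.
Proof.
rewrite -moment_seqZ; apply: eq_moment => k.
by rewrite iter_thetaZ rmorphM.
Qed.

(** The sign (-1)^k from T = -t and the sign (-1)^(k+1) in [inv_mellin] combine to -1. *)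
Lemma mellin_inv g p :
  moment (fun k => iota (inv_mellin g k)) (p \Po (- 'X)) = - mellin g p.
Proof.
rewrite moment_compN -[RHS]mulN1r -moment_seqZ; apply: eq_moment => k.
rewrite inv_mellinE rmorphM rmorphXn rmorphN1 exprS mulrA mulrCA.
by rewrite -expr2 sqrr_sign mulr1.
Qed.

(* Multiplication of g by z turns g(e^w - 1) into (e^w - 1) g(e^w - 1), hence
   acts on Taylor coefficients as the forward difference. *)
Lemma mellin_fdelta g p : mellin (fun k => if k is j.+1 then g j else 0) p
  = mellin g (fdelta p).
Proof.
(* [Z] is multiplication by z, and [thetaZ] is (1+z)(z f)' = z (1+z) f' + z f + f. *)
pose Z (f : series) : series := fun k => if k is j.+1 then f j else 0.
have thetaZ f : theta (Z f) = fun k => Z (theta f) k + Z f k + f k.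
  apply: functional_extensionality => -[|k]; rewrite /theta /=; first by ring.
  by case: k => [|k] /=; ring.
rewrite -[LHS]/(mellin (Z g) p).
elim/poly_ind: p g => [|p c IH] g; first by rewrite !raddf0.
rewrite [fdelta _]raddfD /= fdeltaC addr0 fdeltaMX.
rewrite !raddfD /= mellinC rmorph0 mulr0 addr0.
rewrite !mellinMX thetaZ mellin_seriesD (mellin_seriesD (Z _)) !IH -addrA.
congr (_ + _).
by rewrite -raddfD /fdelta subrK.
Qed.

Lemma mellin_sone p : mellin sone p = p.[0].
Proof.
elim/poly_ind: p => [|p c IH]; first by rewrite raddf0 horner0.
rewrite hornerMXaddC mulr0 add0r raddfD /= mellinC rmorph1 mulr1 mellinMX.
have -> : theta sone = fun k => 0 * sone k.
  by rewrite theta_sone; apply: functional_extensionality => k; rewrite mul0r.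
by rewrite mellin_seriesZ rmorph0 mul0r add0r.
Qed.

(** In the variable w the series is e^(aw) w^j, and applying p(d/dw) at w = 0 gives the j-th
    derivative of p at a. *)
Lemma mellin_binom_log a j p :
  mellin (smul (binom_series a) (sexp log1p_series j)) p = p^`(j).[iota a].
Proof.
elim/poly_ind: p j => [|p c IH] j.
  by rewrite raddf0 derivn_poly0 ?size_poly0 ?horner0.
rewrite raddfD /= mellinC mellinMX.
have -> : theta (smul (binom_series a) (sexp log1p_series j)) = fun k =>
  a * smul (binom_series a) (sexp log1p_series j) k
  + j%:R * smul (binom_series a) (sexp log1p_series j.-1) k.
  by apply: functional_extensionality => k; exact: theta_binom_log.
rewrite mellin_seriesD !mellin_seriesZ !IH rmorph_nat.
rewrite /smul big_ord1 subnn /binom_series /gbinom big_ord0 fact0 divr1 mul1r.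
case: j => [|j].
  by rewrite mul0r addr0 /= rmorph1 mulr1 hornerMXaddC mulrC.
rewrite derivnMXaddC hornerD hornerMn hornerM hornerX.
(* The constant term of log(1+z)^(j+1) is 0, so c contributes nothing. *)
rewrite [sexp _ _ _](_ : _ = 0) ?rmorph0 ?mulr0; last first.
  by rewrite /sexp /= /smul big_ord1 mul0r.
rewrite addr0 /= mulr_natl; ring.
Qed.

Lemma sdivzK (h : series) : h 0%N = 0 ->
  (fun k => if k is j.+1 then sdivz h j else 0) = h.
Proof. by move=> h0; apply: functional_extensionality => -[|k]. Qed.

(** The difference acts as multiplication by z and so undoes [sdivz]; what remains is minus the
    pairing of F with (1+z)^a - 1. *)
Lemma moment_Rfun1_fdelta a F :
  moment (fun k => iota (Rfun a 1 k)) (fdelta F \Po (- 'X))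
  = F.[0] - F.[iota a].
Proof.
rewrite mellin_inv /= -mellin_fdelta sdivzK; last first.
  by rewrite /binom_series /gbinom big_ord0 fact0 divr1 subrr.
have -> : (fun k => binom_series a k - sone k) =
          (fun k => smul (binom_series a) (sexp log1p_series 0) k
                    + (-1) * sone k).
  by apply: functional_extensionality => k; rewrite smuls1 mulN1r.
rewrite mellin_seriesD mellin_seriesZ mellin_binom_log mellin_sone.
by rewrite rmorphN1 mulN1r opprB derivn0.
Qed.

Lemma moment_RfunS_fdelta a s F :
  moment (fun k => iota (Rfun a s.+2 k)) (fdelta F \Po (- 'X))
  = - F^`(s.+1).[iota a].
Proof.
rewrite mellin_inv /= -mellin_fdelta sdivzK ?mellin_binom_log //; last first.
by rewrite /sexp /= /smul !big_ord1 mul0r mulr0.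
Qed.

End MellinFunctional.

(** * Degree and surjectivity of the forward difference *)

Section FdeltaDegree.
Variable L : numFieldType.

Lemma size_XaddC (c : L) : size ('X + c%:P) = 2%N.
Proof. by rewrite -[c]opprK polyCN size_XsubC. Qed.

(** The leading term of (T+1)^n - T^n is n T^(n-1). For n = 0, p is constant and the identity reads
    0 = 0. *)
Lemma fdelta_coef n (p : {poly L}) : (size p <= n.+1)%N ->
  (size (fdelta p) <= n)%N /\ (fdelta p)`_n.-1 = n%:R * p`_n.
Proof.
elim: n p => [|n IH] p sp.
  by rewrite (size1_polyC sp) fdeltaC size_poly0 coef0 mul0r.
have [q [c [-> sq]]] : exists q c, p = q * 'X + c%:P /\ (size q <= n.+1)%N.
  elim/poly_ind: p sp => [|q c _] sp.
    by exists 0, 0; rewrite mul0r add0r size_poly0.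
  exists q, c; split=> //; move: sp; rewrite size_MXaddC; case: eqP => //= ->.
  by rewrite size_poly0.
have [sd cd] := IH _ sq.
rewrite raddfD /= fdeltaC addr0 fdeltaMX.
have sq1 : size (q \Po ('X + 1)) = size q.
  by rewrite size_comp_poly2 ?size_XaddC.
split.
  rewrite (leq_trans (size_polyD _ _)) // geq_max sq1 sq andbT.
  have [->|nz] := eqVneq (fdelta q) 0; first by rewrite mul0r size_poly0.
  by rewrite size_mulX.
rewrite !coefD coefC coefMX coefMX addr0 /=.
have -> : (q \Po ('X + 1))`_n = q`_n.
  by apply/eqP; rewrite -subr_eq0 -coefB -/(fdelta q) nth_default.
case: n {IH sp sq} sd cd => [|n] sd cd; first by rewrite add0r mul1r.
by rewrite cd -[n.+2%:R]natr1 mulrDl mul1r.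
Qed.

Lemma size_fdelta (p : {poly L}) : size (fdelta p) = (size p).-1.
Proof.
case E: (size p) => [|n].
  by move/eqP: E; rewrite size_poly_eq0 => /eqP ->; rewrite raddf0 size_poly0.
have [sd cd] := fdelta_coef (eq_leq E); apply/eqP; rewrite eqn_leq sd /=.
case: n E sd cd => // n E sd cd; rewrite ltnNge; apply/negP => le_dn.
move/eqP: cd; rewrite /= nth_default // eq_sym mulf_eq0 pnatr_eq0 /=.
have -> : p`_n.+1 = lead_coef p by rewrite lead_coefE E.
by rewrite lead_coef_eq0 -size_poly_eq0 E.
Qed.

Lemma size_iter_fdelta n (p : {poly L}) :
  size (iter n (@fdelta L) p) = (size p - n)%N.
Proof. by elim: n => [|n IH]; rewrite ?subn0 //= size_fdelta IH -subnS. Qed.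

(** Induction on the size: a multiple of T^(n+1) takes care of the coefficient of T^n in S. With
    F(0) = 0 the functional for s = 1 reads off -F(alpha). *)
Lemma fdelta_surj (S : {poly L}) :
  exists F, [/\ fdelta F = S, F.[0] = 0 & (size F <= (size S).+1)%N].
Proof.
suff H n (T : {poly L}) : (size T <= n)%N ->
  exists F, [/\ fdelta F = T, F.[0] = 0 & (size F <= n.+1)%N] by exact: H.
elim: n {S} T => [|n IH] S sS.
  exists 0; move: sS; rewrite leqn0 size_poly_eq0 => /eqP ->.
  by rewrite raddf0 horner0 size_poly0.
pose T : {poly L} := (S`_n / n.+1%:R) *: 'X^(n.+1).
have sT : (size T <= n.+2)%N.
  by rewrite (leq_trans (size_scale_leq _ _)) ?size_polyXn.
have [sdT] := fdelta_coef sT.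
rewrite coefZ coefXn eqxx mulr1 mulrC divfK ?pnatr_eq0 //= => cdT.
have [|G [dG G0 sG]] := IH (S - fdelta T).
  apply/leq_sizeP => j le_nj; rewrite coefB.
  have [->|ne] := eqVneq j n; first by rewrite cdT subrr.
  have lt_nj : (n < j)%N by rewrite ltn_neqAle eq_sym ne.
  rewrite !nth_default ?subrr //; first exact: leq_trans sdT _.
  exact: leq_trans sS _.
exists (G + T); split; first by rewrite raddfD /= dG subrK.
  by rewrite hornerD hornerZ hornerXn expr0n mulr0 addr0.
by rewrite (leq_trans (size_polyD _ _)) // geq_max sT andbT ltnW.
Qed.

End FdeltaDegree.

(** * Multiplicities of roots in characteristic 0 *)

Section Multiplicity.
Variable L : numFieldType.
Implicit Types (F : {poly L}) (a c : L).

Lemma dvdp_expXsubC_deriv a m F :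
  (('X - a%:P) ^+ m.+1 %| F) = root F a && (('X - a%:P) ^+ m %| F^`()).
Proof.
apply/idP/andP => [/dvdpP[G ->]|[rF dF]].
  rewrite rootE hornerM horner_exp hornerXsubC subrr expr0n mulr0; split=> //.
  rewrite derivM deriv_exp derivXsubC mul1r exprS mulrA dvdp_add ?dvdp_mull //.
  by rewrite -mulr_natl dvdp_mull.
have [->|F0] := eqVneq F 0; first by rewrite dvdp0.
have [r [H nH eF]] := multiplicity_XsubC F a; rewrite F0 /= in nH.
case: r eF => [|r] eF.
  by move: rF nH; rewrite eF expr0 mulr1 => ->.
have [le_mr|lt_rm] := leqP m r; first by rewrite eF dvdp_mull // dvdp_exp2l.
(* If the multiplicity were r+1 <= m, the summand (r+1) H (X - a)^r of F' would be divisible by (X -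
   a)^(r+1). *)
suff: root H a by rewrite (negPf nH).
have : ('X - a%:P) ^+ r.+1 %| F^`() by apply: dvdp_trans dF; exact: dvdp_exp2l.
rewrite eF derivM deriv_exp derivXsubC mul1r dvdp_addr; last exact: dvdp_mull.
rewrite -mulr_natr mulrCA exprS mulrC dvdp_mul2l ?expf_neq0 ?polyXsubC_eq0 //.
rewrite -polyC_natr mulrC mul_polyC dvdpZr ?pnatr_eq0 //.
by rewrite dvdp_XsubCl.
Qed.

Lemma dvdp_expXsubCP a m F :
  reflect (forall s, (s < m)%N -> F^`(s).[a] = 0) (('X - a%:P) ^+ m %| F).
Proof.
elim: m F => [|m IH] F; first by rewrite expr0 dvd1p; left.
rewrite dvdp_expXsubC_deriv.
apply: (iffP andP) => [[/rootP rF /IH dF] [|s] lt_s|dF].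
- by [].
- by rewrite derivSn dF.
- split; first by apply/rootP/(dF 0%N).
  by apply/IH => s lt_s; rewrite -derivSn dF.
Qed.

(** The coprime powers multiply to a divisor of degree sum mu, which exceeds the degree of F. *)
Lemma prod_expXsubC_dvdp (I : finType) (b : I -> L) (mu : I -> nat) F :
    injective b -> (forall i, ('X - (b i)%:P) ^+ mu i %| F) ->
    (size F <= \sum_i mu i)%N -> F = 0.
Proof.
move=> injb dvF sF; apply/eqP/negPn/negP => F0.
suff: \prod_i ('X - (b i)%:P) ^+ mu i %| F.
  move/(dvdp_leq F0); rewrite leqNgt => /negP; apply.
  suff -> : size (\prod_i ('X - (b i)%:P) ^+ mu i) = (\sum_i mu i).+1 by [].
  rewrite size_prod => [|i _]; last by rewrite expf_neq0 ?polyXsubC_eq0.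
  under eq_bigr do rewrite size_exp_XsubC -addn1.
  by rewrite big_split /= sum1_card subSn ?addnK ?leq_addl.
elim: (index_enum I) (index_enum_uniq I) => [|i s IH] /= us.
  by rewrite big_nil dvd1p.
case/andP: us => nis us; rewrite big_cons Gauss_dvdp ?dvF ?IH //.
apply: coprimep_expl; rewrite coprimep_sym coprimep_XsubC rootE horner_prod.
rewrite prodf_seq_neq0; apply/allP => j js /=.
rewrite horner_exp hornerXsubC expf_neq0 // subr_eq0.
by apply: contraNneq nis => /injb ->.
Qed.

Lemma dvdp_expXsubC_comp c m F :
  ('X - c%:P) ^+ m %| F -> ('X - (c - 1)%:P) ^+ m %| F \Po ('X + 1).
Proof.
move/(dvdp_comp_poly ('X + 1)); rewrite rmorphXn /= comp_polyB comp_polyX.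
by rewrite comp_polyC polyCB opprB addrA.
Qed.

End Multiplicity.

(** * The perfectness argument for an abstract orthogonality condition *)

Section Perfectness.
Variables (L : numFieldType) (I : finType) (a : I -> L) (mu : I -> nat).
Hypothesis a_sep : forall i j (e f : nat), a i - e%:R = a j - f%:R -> i = j.

(** Stands for annihilation by all the functionals; its links with [vanish] translate annihilation
    of [fdelta F] into zeros of F. *)
Variable Ann : {poly L} -> Prop.
Hypothesis Ann_linear : forall c p q, Ann p -> Ann q -> Ann (c *: p + q).

Definition vanish (c : L) (F : {poly L}) : Prop :=
  forall i, ('X - (a i + c)%:P) ^+ mu i %| F.

Hypothesis Ann_fdelta : forall F, vanish 0 F -> Ann (fdelta F).
Hypothesis vanish_Ann : forall F, F.[0] = 0 -> Ann (fdelta F) -> vanish 0 F.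

Lemma vanish_comp c F : vanish c F -> vanish (c - 1) (F \Po ('X + 1)).
Proof. by move=> vF i; rewrite addrA; exact: dvdp_expXsubC_comp. Qed.

Lemma vanishB c F G : vanish c F -> vanish c G -> vanish c (F - G).
Proof. by move=> vF vG i; rewrite dvdp_sub ?vF ?vG. Qed.

Lemma vanishM c F G : vanish c G -> vanish c (F * G).
Proof. by move=> vG i; rewrite dvdp_mull ?vG. Qed.

Lemma AnnB p q : Ann p -> Ann q -> Ann (p - q).
Proof.
by move=> Ap Aq; rewrite addrC -scaleN1r; exact: Ann_linear.
Qed.

(** Each difference involves A(T+1), whose zeros are moved by -1, so n differences consume the
    translates a_i, ..., a_i + n. *)
Lemma vanish_iter_fdelta n A :
  (forall e, (e <= n)%N -> vanish e%:R A) -> vanish 0 (iter n (@fdelta L) A).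
Proof.
elim: n A => [|n IH] A vA; first exact: (vA 0%N).
rewrite iterSr; apply: IH => e le_en; apply: vanishB; last exact/vA/leqW.
by have := vanish_comp (vA e.+1 le_en); rewrite -natr1 addrK.
Qed.

Lemma iter_fdelta_comp n (A : {poly L}) :
  iter n (@fdelta L) A \Po ('X + 1) = iter n (@fdelta L) (A \Po ('X + 1)).
Proof.
by elim: n => //= n <-; rewrite /fdelta comp_polyB.
Qed.

(** Repeated summation by parts: each step lowers the degree of q and replaces A by A(T+1), at the
    cost of one translate of the zeros. *)
Lemma Ann_iter_fdelta n A (q : {poly L}) :
    (forall e, (e < n)%N -> vanish e%:R A) -> (size q <= n)%N ->
  Ann (q * iter n (@fdelta L) A).
Proof.
elim: n A q => [|n IH] A q vA sq.
  move: sq; rewrite leqn0 size_poly_eq0 => /eqP ->.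
  by rewrite mul0r -(raddf0 (@fdelta L)); apply: Ann_fdelta => i; rewrite dvdp0.
have -> : q * iter n.+1 (@fdelta L) A = fdelta (q * iter n (@fdelta L) A)
    - fdelta q * iter n (@fdelta L) (A \Po ('X + 1)).
  by rewrite -iter_fdelta_comp fdeltaM addrK.
apply: AnnB; first by apply/Ann_fdelta/vanishM/vanish_iter_fdelta.
apply: IH => [e lt_en|]; last by rewrite size_fdelta; lia.
by have := vanish_comp (vA e.+1 lt_en); rewrite -natr1 addrK.
Qed.

(** By [a_sep] the points a_i - e - 1 are distinct, so their multiplicities add up to k sum mu. *)
Lemma vanish_eq0 k (S : {poly L}) :
    (forall e, (e < k)%N -> vanish (- e.+1%:R) S) ->
    (size S <= k * \sum_i mu i)%N -> S = 0.
Proof.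
move=> vS sS.
apply: (@prod_expXsubC_dvdp _ _ (fun p : I * 'I_k => a p.1 - p.2.+1%:R)
   (fun p => mu p.1)).
- move=> [i e] [j f] /= e_ij; have e_i := a_sep e_ij; move: e_ij.
  rewrite e_i => /addrI/oppr_inj/eqP; rewrite eqr_nat eqSS => /eqP e_ef.
  by congr (_, _); exact: val_inj.
- by move=> [i e] /=; exact: vS.
rewrite -(pair_bigA _ (fun i (e : 'I_k) => mu i)) /=.
under eq_bigr do rewrite sum_nat_const card_ord.
by rewrite -big_distrr.
Qed.

(** The induction trades orthogonality for zeros: passing from S = [fdelta F] to F(T+1) gains one
    translate of zeros and loses one degree of orthogonality. The size grows by at most 1, offset by
    the drop of n. *)
Lemma Ann_perfect n k (S : {poly L}) :
    (forall e, (e < k)%N -> vanish (- e.+1%:R) S) ->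
    (forall q : {poly L}, (size q <= n)%N -> Ann (q * S)) ->
    (size S + n <= (k + n) * \sum_i mu i)%N -> S = 0.
Proof.
elim: n k S => [|n IH] k S vS AS sS.
  by apply: (@vanish_eq0 k) => //; move: sS; rewrite !addn0.
have [F [dF F0 sF]] := fdelta_surj S.
have vF : vanish 0 F.
  apply: vanish_Ann => //; rewrite dF -[S]mul1r; apply: AS.
  by rewrite size_poly1.
have vFe e : (e <= k)%N -> vanish (- e%:R) F.
  elim: e => [|e IHe] lt_ek; first by rewrite oppr0.
  (* This recursion carries the zeros of F from a_i - e to a_i - e - 1. *)
  have -> : F = (F \Po ('X + 1)) - S by rewrite -dF /fdelta subKr.
  apply: vanishB; last exact: vS.
  have := vanish_comp (IHe (ltnW lt_ek)).
  by rewrite -opprD natr1.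
suff F'0 : F \Po ('X + 1) = 0.
  rewrite -dF /fdelta F'0 sub0r; apply/eqP; rewrite oppr_eq0.
  by rewrite -(comp_poly2_eq0 F (size_XaddC 1)) F'0.
apply: (IH k.+1) => [e lt_ek|r sr|].
- have := vanish_comp (vFe e lt_ek).
  by rewrite -opprD natr1.
- have [q [dq _ sq]] := fdelta_surj r.
  (* Summation by parts, with r written as the difference of q. *)
  have -> : r * (F \Po ('X + 1)) = fdelta (q * F) - q * S.
    by rewrite fdeltaM dF dq addrAC subrr add0r.
  apply: AnnB; first exact/Ann_fdelta/vanishM.
  by apply: AS; rewrite (leq_trans sq).
rewrite size_comp_poly2 ?size_XaddC // addSnnS; apply: leq_trans sS.
by rewrite addnS -addSn leq_add2r.
Qed.

(** S is orthogonal to degree n, one more than the iterated difference of A: dividing q by X - x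
    leaves the multiple q(x) S, annihilated by assumption. The induction then starts with no known
    zeros, k = 0. *)
Lemma Ann_kernel n M (A S : {poly L}) x : (\sum_i mu i = M.+1)%N ->
    (forall e, (e < n)%N -> vanish e%:R A) ->
    (size A <= n * M.+1 + M.+1)%N ->
    iter n (@fdelta L) A = S * ('X - x%:P) -> Ann S -> S = 0.
Proof.
move=> sum_mu vA sA eS AS.
apply: (@Ann_perfect n.+1 0) => // [q sq|].
  have [r er] : exists r, q - q.[x]%:P = r * ('X - x%:P).
    by apply/factor_theorem; rewrite rootE hornerD hornerN hornerC subrr.
  have -> : q * S = q.[x] *: S + r * iter n (@fdelta L) A.
    by rewrite eS mulrCA -er -mul_polyC; ring.
  rewrite addrC -[r * _]scale1r; apply: Ann_linear; last first.
    rewrite -[_ *: _]addr0; apply: Ann_linear => //.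
    by rewrite -(subrr S); exact: AnnB.
  apply: Ann_iter_fdelta => //.
  have [->|r0] := eqVneq r 0; first by rewrite size_poly0.
  have := congr1 (fun p : {poly L} => size p) er.
  rewrite /= size_Mmonic ?monicXsubC // size_XsubC addn2 /= => sr.
  rewrite -ltnS -sr (leq_trans (size_polyD _ _)) // geq_max sq size_polyN.
  by rewrite (leq_trans (size_polyC_leq1 _)).
rewrite sum_mu add0n.
have [->|S0] := eqVneq S 0; first by rewrite size_poly0 add0n; lia.
(* Here size S + 1 = size A - n, whence size S + n + 1 <= (n + 1)(M + 1). *)
have := congr1 (fun p : {poly L} => size p) eS.
rewrite /= size_iter_fdelta size_Mmonic ?monicXsubC // size_XsubC addn2 /=.
by move: sA; rewrite mulSn; move: (n * M.+1)%N (size A) (size S) => *; lia.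
Qed.

End Perfectness.

(** * Degrees, zeros and differences of the A_{n,l} *)

Lemma size_comb_eq0 (L : fieldType) k b (p : 'I_k -> {poly L}) (c : 'I_k -> L) :
    (forall l, size (p l) = (b + l.+1)%N) -> \sum_l c l *: p l = 0 ->
  forall l, c l = 0.
Proof.
move=> sp sum0 l0; apply/eqP/negPn/negP => cl0.
(* For l maximal with c l nonzero, the coefficient of degree b + l comes from p l alone. *)
case: (@arg_maxnP _ l0 (fun l => c l != 0) (fun l => val l) cl0) => l cl max_l.
have := congr1 (fun q : {poly L} => q`_(b + l)) sum0.
rewrite coef0 coef_sum (bigD1 l) //= big1 => [|j ne_jl].
  rewrite addr0 coefZ; apply/eqP; rewrite mulf_neq0 //.
  have -> : (b + l)%N = (size (p l)).-1 by rewrite sp addnS.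
  by rewrite -lead_coefE lead_coef_eq0 -size_poly_eq0 sp addnS.
rewrite coefZ; have [->|/max_l le_jl] := eqVneq (c j) 0; first by rewrite mul0r.
rewrite nth_default ?mulr0 // sp addnS ltn_add2l ltn_neqAle.
by apply/andP; split.
Qed.

Lemma poch_dvdp (x : {poly rat}) n e : (e < n)%N -> x + e%:R %| poch x n.
Proof.
by move=> lt_en; rewrite /poch (bigD1 (Ordinal lt_en)) //= dvdp_mulr.
Qed.

Lemma size_poch c n : size (poch ('X + c%:P) n) = n.+1.
Proof.
rewrite /poch (eq_bigr (fun k : 'I_n => 'X - (- (c + k%:R))%:P)) => [|k _].
  by rewrite size_prod_XsubC /index_enum -enumT size_enum_ord.
by rewrite polyCN opprK polyCD polyC_natr addrA.
Qed.

(** Under t = -T the shift t -> t - 1 becomes T -> T + 1. *)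
Lemma deltaN1_compN (L : numFieldType) (iota : {rmorphism rat -> L}) P n :
  map_poly iota (iter n deltaN1 P) \Po (- 'X)
  = iter n (@fdelta L) (map_poly iota P \Po (- 'X)).
Proof.
elim: n => //= n <-; move: (iter n _ P) => {}P.
rewrite /deltaN1 /fdelta rmorphB /= map_comp_poly comp_polyB -!comp_polyA.
rewrite rmorphB /= map_polyX rmorph1 !rmorphB /= !rmorphN /= !comp_polyX.
by rewrite opprD -polyC1 comp_polyC.
Qed.

Lemma signfact_neq0 k : (-1) ^+ k / k`!%:R != 0 :> rat.
Proof.
by rewrite mulf_neq0 ?signr_eq0 // invr_eq0 pnatr_eq0 -lt0n fact_gt0.
Qed.

Section Columns.
Variables (d : nat) (m : 'I_d -> nat) (alpha : 'I_d -> rat) (n : nat).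

Lemma size_Apoly l :
  size (Apoly m alpha n l) = (n * (\sum_i (m i).+1) + l.+1)%N.
Proof.
have sc k c : size (((-1) ^+ k / k`!%:R) *: poch ('X + c%:P) k) = k.+1.
  by rewrite size_scale ?signfact_neq0 // size_poch.
have sl : size (((-1) ^+ l / l`!%:R) *: poch 'X l) = l.+1.
  by rewrite -[X in poch X]addr0 -polyC0 sc.
pose w i := ((-1) ^+ n / n`!%:R) *: poch ('X + (alpha i)%:P) n.
have wz i : w i ^+ (m i).+1 != 0 by rewrite expf_neq0 // -size_poly_eq0 sc.
rewrite /Apoly (eq_bigr (fun i => w i ^+ (m i).+1)) // size_mul; last 2 first.
- by rewrite -size_poly_eq0 sl.
- exact/prodf_neq0.
rewrite sl size_prod //.
have -> : (\sum_(i < d) size (w i ^+ (m i).+1)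
           = \sum_(i < d) (n * (m i).+1 + 1))%N.
  apply: eq_bigr => i _; rewrite addn1.
  have := size_exp (w i) (m i).+1; rewrite sc /= => <-.
  by rewrite prednK // lt0n size_poly_eq0.
rewrite big_split /= sum1_card -big_distrr /= subSn ?leq_addl // addnK.
by rewrite addnC addSn addnS.
Qed.

Lemma Apoly_dvdp l i e : (e < n)%N ->
  ('X + (alpha i)%:P + e%:R) ^+ (m i).+1 %| Apoly m alpha n l.
Proof.
move=> lt_en; rewrite /Apoly dvdp_mull // (bigD1 i) //= dvdp_mulr //.
by rewrite dvdp_exp2r // dvdpZr ?poch_dvdp ?signfact_neq0.
Qed.

End Columns.

(** * The kernel of the specialised matrix *)

Section Kernel.
Variables (d : nat) (hd : (0 < d)%N) (m : 'I_d -> nat) (alpha : 'I_d -> rat).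
Hypothesis halpha1 : alpha (Ordinal hd) = 0.
Hypothesis halpha : forall i j : 'I_d, i != j ->
  alpha i - alpha j \isn't a Num.int.
Variables (L : numFieldType) (iota : {rmorphism rat -> L}).

Let a i := iota (alpha i).
Let mu i := (m i).+1.

Definition momentR i s : {poly L} -> L :=
  moment (fun k => iota (Rfun (alpha i) s k)).

HB.instance Definition _ i s := GRing.Linear.on (momentR i s).

(** S is a polynomial in T = -t. The excluded pair (1,1) is included here; [momentR_excluded]
    settles it. *)
Definition annihilated (S : {poly L}) : Prop :=
  forall i s, (s <= m i)%N -> momentR i s.+1 (S \Po (- 'X)) = 0.

Lemma iota_alpha_sep i j (e f : nat) :
  a i - e%:R = a j - f%:R -> i = j.
Proof.
move=> eq_ij; apply/eqP/negPn/negP => /halpha/negP; apply.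
have -> : alpha i - alpha j = e%:R - f%:R.
  apply: (fmorph_inj iota); rewrite !rmorphB !rmorph_nat /=.
  by move: eq_ij; rewrite /a => /eqP; rewrite subr_eq => /eqP ->; ring.
by rewrite rpredB ?rpred_nat.
Qed.

Lemma annihilated_linear c p q :
  annihilated p -> annihilated q -> annihilated (c *: p + q).
Proof.
move=> Ap Aq i s le_s; rewrite comp_polyD comp_polyZ linearP /=.
by rewrite Ap // Aq // mulr0 addr0.
Qed.

Lemma annihilated_fdelta F : vanish a mu 0 F -> annihilated (fdelta F).
Proof.
move=> vF i [|s] le_s.
  rewrite /momentR moment_Rfun1_fdelta.
  have vFi j : F.[a j] = 0.
    by have := vF j; rewrite addr0 => /dvdp_expXsubCP/(_ 0%N isT).
  (* As alpha_1 = 0, the value F(0) is F(alpha_1), which vanishes too. *)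
  by have := vFi (Ordinal hd); rewrite /a halpha1 rmorph0 vFi subr0.
rewrite /momentR moment_RfunS_fdelta; apply/eqP; rewrite oppr_eq0; apply/eqP.
by have := vF i; rewrite addr0 => /dvdp_expXsubCP; apply.
Qed.

Lemma vanish_annihilated F :
  F.[0] = 0 -> annihilated (fdelta F) -> vanish a mu 0 F.
Proof.
move=> F0 AF i; rewrite addr0; apply/dvdp_expXsubCP => -[|s] le_s.
  have := AF i 0%N isT; rewrite /momentR moment_Rfun1_fdelta F0 sub0r.
  by move/eqP; rewrite oppr_eq0 => /eqP.
have := AF i s.+1 le_s; rewrite /momentR moment_RfunS_fdelta.
by move/eqP; rewrite oppr_eq0 => /eqP.
Qed.

(** Every polynomial is a difference, and for alpha_1 = 0 the functional gives F(0) - F(0). *)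
Lemma momentR_excluded S : momentR (Ordinal hd) 1 S = 0.
Proof.
have [F [dF _ _]] := fdelta_surj (S \Po (- 'X)).
have <- : fdelta F \Po (- 'X) = S.
  by rewrite dF -comp_polyA raddfN /= comp_polyX opprK comp_polyXr.
by rewrite /momentR moment_Rfun1_fdelta halpha1 rmorph0 subrr.
Qed.

Lemma Mdim_sum : (\sum_i mu i)%N = (Mdim m).+1.
Proof.
rewrite /mu /Mdim; under eq_bigr do rewrite -addn1.
by rewrite big_split /= sum1_card card_ord; lia.
Qed.

Lemma iter_fdelta_sum n (J : finType) (c : J -> L) (F : J -> {poly L}) :
  iter n (@fdelta L) (\sum_j c j *: F j)
  = \sum_j c j *: iter n (@fdelta L) (F j).
Proof.
elim: n => //= n ->; rewrite linear_sum.
by apply: eq_bigr => j _; rewrite linearZ.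
Qed.

Variables (n : nat) (x : L).

Lemma Apoly_vanish l e : (e < n)%N ->
  vanish a mu e%:R (map_poly iota (Apoly m alpha n l) \Po (- 'X)).
Proof.
move=> lt_en i; have := Apoly_dvdp m alpha l i lt_en.
rewrite -(dvdp_map iota) => /(dvdp_comp_poly (- 'X)).
rewrite !rmorphXn /= -addrA -polyC_natr -polyCD rmorphD /= map_polyX map_polyC.
rewrite comp_polyD comp_polyX comp_polyC /= rmorphD rmorph_nat -/(a i).
rewrite addrC -opprB -scaleN1r exprZn dvdpZl //.
by rewrite signr_eq0.
Qed.

(** Specialisation z = x after extension of scalars; applied to coefficients, it leaves t free. *)
Let ev : {rmorphism {poly rat} -> L} := horner_eval x \o map_poly iota.

Lemma ev_Qpoly i s l :
  ev (Qpoly m alpha n i s l)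
  = momentR i s (map_poly ev (divdiff (Ppoly m alpha n l))).
Proof.
rewrite /Qpoly /phi rmorph_sum /momentR (momentE _ (size_poly _ _)).
apply: eq_bigr => k _; rewrite coef_map /= !horner_evalE linearZ /=.
by rewrite hornerZ mulrC.
Qed.

Lemma ev_divdiff P :
  map_poly ev (divdiff P) * (x%:P - 'X)
  = ((map_poly iota P).[x])%:P - map_poly iota P.
Proof.
have := congr1 (map_poly ev) (divdiffK P).
rewrite rmorphM !rmorphB /= map_polyX !map_polyC /= horner_evalE map_polyX.
rewrite hornerX => ->; rewrite horner_evalE -map_poly_comp_id0; last first.
  by rewrite rmorph0.
congr (_ - _); apply: eq_map_poly => c /=.
by rewrite horner_evalE map_polyC hornerC.
Qed.

Lemma pvec_kernel (c : 'I_(Mdim m).+1 -> L) :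
    (forall r, \sum_l c l * ev (pvec m alpha n l r 0) = 0) ->
  forall l, c l = 0.
Proof.
move=> ker.
pose P := \sum_l c l *: map_poly iota (Ppoly m alpha n (val l)).
pose S := \sum_l c l *: map_poly ev (divdiff (Ppoly m alpha n (val l))).
pose A := \sum_l c l *: (map_poly iota (Apoly m alpha n (val l)) \Po (- 'X)).
(* The first row of the kernel relation; it makes S equal to P / (t - x). *)
have Px : P.[x] = 0.
  have := ker ord0; rewrite horner_sum => {2}<-; apply: eq_bigr => l _.
  by rewrite /pvec mxE /= hornerZ.
have PS : P = S * ('X - x%:P).
  rewrite -opprB mulrN mulr_suml; apply/eqP; rewrite -addr_eq0; apply/eqP.
  transitivity (P.[x])%:P; last by rewrite Px.
  rewrite horner_sum rmorph_sum -big_split; apply: eq_bigr => l _ /=.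
  rewrite -scalerAl ev_divdiff scalerBr addrC subrK hornerZ.
  by rewrite polyCM mul_polyC.
have dA : iter n (@fdelta L) A = P \Po (- 'X).
  rewrite iter_fdelta_sum /P linear_sum /=; apply: eq_bigr => l _.
  by rewrite -deltaN1_compN comp_polyZ.
have S0 : S = 0.
  (* Under t = -T the factor t - x becomes -(T + x): hence the sign here and the point - x below. *)
  suff: - (S \Po (- 'X)) = 0.
    move/eqP; rewrite oppr_eq0 comp_poly2_eq0 => [/eqP //|].
    by rewrite size_polyN size_polyX.
  apply: (Ann_kernel iota_alpha_sep annihilated_linear annihilated_fdelta
    vanish_annihilated Mdim_sum (n := n) (A := A) (x := - x)).
  - move=> e lt_en i; apply: (big_ind (fun F => _ %| F)) => [|F G|l _].
    + exact: dvdp0.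
    + exact: dvdp_add.
    by rewrite -mul_polyC dvdp_mull //; exact: Apoly_vanish.
  - rewrite (leq_trans (size_sum _ _ _)) //; apply/bigmax_leqP => l _.
    rewrite (leq_trans (size_scale_leq _ _)) // size_comp_poly2; last first.
      by rewrite size_polyN size_polyX.
    rewrite size_map_poly size_Apoly Mdim_sum leq_add2l; exact: ltn_ord.
  - rewrite dA PS comp_polyM comp_polyB comp_polyX comp_polyC polyCN opprK.
    by rewrite mulNr -mulrN opprD.
  move=> i s le_s; rewrite [(- _) \Po _]raddfN /= -comp_polyA.
  rewrite [(- 'X) \Po _]raddfN /= comp_polyX opprK comp_polyXr raddfN /=.
  apply/eqP; rewrite oppr_eq0; apply/eqP.
  have [is01|is01] := eqVneq (val i, s.+1) (0%N, 1%N).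
    case: is01 => i0 ->; have -> : i = Ordinal hd by exact: val_inj.
    exact: momentR_excluded.
  have is_I : (i, s.+1) \in Iset m.
    rewrite mem_filter is01 andTb.
    apply: allpairs_f_dep; first by rewrite mem_enum.
    by rewrite mem_iota.
  (* Row 0 holds P, so the entry for (i, s) sits one place after its index in [Iset]. *)
  have lt_I : ((index (i, s.+1) (Iset m)).+1 < (Mdim m).+1)%N.
    by rewrite ltnS -(size_Iset m hd) index_mem.
  have := ker (Ordinal lt_I); rewrite linear_sum /= => {2}<-.
  apply: eq_bigr => l _; rewrite linearZ /= /pvec mxE /=.
  rewrite (nth_map (i, s.+1)) ?index_mem // nth_index //=.
  by rewrite -ev_Qpoly.
(* Now P = 0, while P_{n,l} has degree n M + l, strictly increasing in l. *)
apply: (@size_comb_eq0 _ _ (n * Mdim m)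
  (fun l => map_poly iota (Ppoly m alpha n (val l)))).
  move=> l; rewrite -(@size_comp_poly2 _ _ (- 'X)); last first.
    by rewrite size_polyN size_polyX.
  rewrite deltaN1_compN size_iter_fdelta size_comp_poly2; last first.
    by rewrite size_polyN size_polyX.
  by rewrite size_map_poly size_Apoly Mdim_sum mulnS -addnA addKn.
by rewrite -/P PS S0 mul0r.
Qed.

End Kernel.

(** * The constant determinant and linear independence *)

Theorem theorem8p10 (d : nat) (hd : (0 < d)%N)
    (m : 'I_d -> nat) (hm : forall i, (0 < m i)%N)
    (alpha : 'I_d -> rat)
    (halpha1 : alpha (Ordinal hd) = 0)
    (halpha : forall i j : 'I_d, i != j ->
       alpha i - alpha j \isn't a Num.int)
    (n : nat) :
  (exists a : rat, a != 0 /\ \det (Mat m alpha n) = a%:P) /\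
  (forall x : rat,
     free [seq pvec_at m alpha n l x | l : 'I_(Mdim m).+1]).
Proof.
split.
  (* Size 1 means a nonzero constant. The size is unchanged over [algC], where any other size, 0
     included, yields a root x. *)
  suff /size_poly1P[a a0 ->] : size (\det (Mat m alpha n)) == 1%N by exists a.
  rewrite -(size_map_poly (ratr : {rmorphism rat -> algC})).
  apply/negPn/negP => /closed_rootP[x]; rewrite rootE -horner_evalE.
  rewrite -[horner_eval x _]/((horner_eval x \o map_poly ratr) _).
  (* [det0P] provides a left kernel vector; the transpose turns it into a relation between
     columns. *)
  rewrite -det_map_mx -det_tr.
  case/det0P => v v0 vM; case/eqP: v0; apply/rowP => l; rewrite mxE.
  apply: (pvec_kernel halpha1 halpha (iota := ratr) (n := n) (x := x)) => r.
  have := congr1 (fun w : 'rV_ _ => w 0 r) vM; rewrite !mxE => {2}<-.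
  by apply: eq_bigr => j _; rewrite !mxE.
move=> x.
have -> : [seq pvec_at m alpha n l x | l : 'I_(Mdim m).+1]
  = map_tuple (fun l : 'I_(Mdim m).+1 => pvec_at m alpha n l x)
      (ord_tuple _) by [].
apply/freeP => c sum0.
(* A rational point needs no extension of scalars, so the embedding is the identity. *)
apply: (pvec_kernel halpha1 halpha (iota := idfun) (n := n) (x := x)) => r.
have := congr1 (fun w : 'cV_ _ => w r 0) sum0; rewrite summxE mxE => {2}<-.
apply: eq_bigr => l _; rewrite (nth_map ord0) ?size_enum_ord // nth_ord_enum.
by rewrite !mxE /= horner_evalE map_poly_id.
Qed.
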